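(* The following problem is undecidable: given a HyperLTL sentence $\varphi$ of the form $\forall\pi_1.\forall\pi_2.\exists\tau_1\cdots\exists\tau_m.\psi$ that belongs to $\mathrm{HyperLTL}^1(\mathbf{F},\mathbf{G})$, decide whether $\varphi$ is satisfiable.
   Context: HyperLTL formulas over a finite set $AP$ of propositions: $\phi ::= \exists\pi.\phi \mid \forall\pi.\phi \mid \psi$, $\psi ::= a_\pi \mid \neg\psi \mid \psi\vee\psi \mid \mathbf{X}\psi \mid \psi\,\mathbf{U}\,\psi$, with $\mathbf{F}\psi=\mathrm{true}\,\mathbf{U}\psi$, $\mathbf{G}\psi=\neg\mathbf{F}\neg\psi$. Semantics over a set $T$ of traces (infinite sequences of subsets of $AP$): quantifiers range over $T$, temporal operators shift all assigned traces synchronously. A sentence is satisfiable if it has a nonempty model. The fragment $\mathrm{HyperLTL}^1(\mathbf{F},\mathbf{G})$ consists of formulas generated by $\phi ::= \exists\pi.\phi \mid \forall\pi.\phi \mid \psi$, $\psi ::= \neg\psi \mid \psi\vee\psi \mid \psi\wedge\psi \mid \mathbf{F}\psi' \mid \mathbf{G}\psi' \mid \psi'$, $\psi' ::= a_\pi \mid \neg\psi' \mid \psi'\vee\psi' \mid \psi'\wedge\psi'$ (temporal depth one, only $\mathbf{F}$ and $\mathbf{G}$). *)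

(* Defs.v *)
From mathcomp Require Import all_boot.
From Stdlib Require Cantor.

Set Implicit Arguments.
Unset Strict Implicit.
Unset Printing Implicit Defensive.

Section HyperLTL.

Variable AP : finType.

(* Trace variables are natural numbers.  [Tt] is primitive because it cannot
   be expressed from atoms without introducing a free trace variable; it is
   only needed for the abbreviation F psi = true U psi. *)
Inductive ltl : Type :=
| Tt
| Atom (a : AP) (pi : nat)
| Not (psi : ltl)
| Or (psi1 psi2 : ltl)
| Next (psi : ltl)
| Until (psi1 psi2 : ltl).

Definition And (psi1 psi2 : ltl) : ltl := Not (Or (Not psi1) (Not psi2)).
Definition Finally (psi : ltl) : ltl := Until Tt psi.
Definition Globally (psi : ltl) : ltl := Not (Finally (Not psi)).

Inductive hyperltl : Type :=
| Exists (pi : nat) (phi : hyperltl)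
| Forall (pi : nat) (phi : hyperltl)
| Body (psi : ltl).

Fixpoint fv_ltl (psi : ltl) : seq nat :=
  match psi with
  | Tt => [::]
  | Atom _ pi => [:: pi]
  | Not psi1 | Next psi1 => fv_ltl psi1
  | Or psi1 psi2 | Until psi1 psi2 => fv_ltl psi1 ++ fv_ltl psi2
  end.

Fixpoint fv (phi : hyperltl) : seq nat :=
  match phi with
  | Exists pi phi1 | Forall pi phi1 => [seq x <- fv phi1 | x != pi]
  | Body psi => fv_ltl psi
  end.

Definition sentence (phi : hyperltl) : Prop := fv phi = [::].

Definition trace : Type := nat -> {set AP}.

Definition suffix (j : nat) (t : trace) : trace := fun i => t (j + i).

Definition assignment : Type := nat -> option trace.

Definition empty_assignment : assignment := fun _ => None.

Definition update (Pi : assignment) (pi : nat) (t : trace) : assignment :=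
  fun x => if x == pi then Some t else Pi x.

Definition shift (j : nat) (Pi : assignment) : assignment :=
  fun x => omap (suffix j) (Pi x).

Fixpoint ltl_sat (Pi : assignment) (psi : ltl) : Prop :=
  match psi with
  | Tt => True
  | Atom a pi => if Pi pi is Some t then a \in t 0 else False
  | Not psi1 => ~ ltl_sat Pi psi1
  | Or psi1 psi2 => ltl_sat Pi psi1 \/ ltl_sat Pi psi2
  | Next psi1 => ltl_sat (shift 1 Pi) psi1
  | Until psi1 psi2 =>
      exists j : nat, ltl_sat (shift j Pi) psi2 /\
        forall k : nat, k < j -> ltl_sat (shift k Pi) psi1
  end.

Fixpoint hyperltl_sat (T : trace -> Prop) (Pi : assignment) (phi : hyperltl) :
    Prop :=
  match phi with
  | Exists pi phi1 =>
      exists t : trace, T t /\ hyperltl_sat T (update Pi pi t) phi1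
  | Forall pi phi1 =>
      forall t : trace, T t -> hyperltl_sat T (update Pi pi t) phi1
  | Body psi => ltl_sat Pi psi
  end.

Definition models (T : trace -> Prop) (phi : hyperltl) : Prop :=
  hyperltl_sat T empty_assignment phi.

Definition satisfiable (phi : hyperltl) : Prop :=
  exists T : trace -> Prop, (exists t : trace, T t) /\ models T phi.

Inductive propositional : ltl -> Prop :=
| prop_atom a pi : propositional (Atom a pi)
| prop_not psi : propositional psi -> propositional (Not psi)
| prop_or psi1 psi2 :
    propositional psi1 -> propositional psi2 -> propositional (Or psi1 psi2)
| prop_and psi1 psi2 :
    propositional psi1 -> propositional psi2 -> propositional (And psi1 psi2).

Inductive ltl1_FG : ltl -> Prop :=
| FG_not psi : ltl1_FG psi -> ltl1_FG (Not psi)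
| FG_or psi1 psi2 : ltl1_FG psi1 -> ltl1_FG psi2 -> ltl1_FG (Or psi1 psi2)
| FG_and psi1 psi2 : ltl1_FG psi1 -> ltl1_FG psi2 -> ltl1_FG (And psi1 psi2)
| FG_finally psi : propositional psi -> ltl1_FG (Finally psi)
| FG_globally psi : propositional psi -> ltl1_FG (Globally psi)
| FG_prop psi : propositional psi -> ltl1_FG psi.

Inductive hyperltl1_FG : hyperltl -> Prop :=
| FG_exists pi phi : hyperltl1_FG phi -> hyperltl1_FG (Exists pi phi)
| FG_forall pi phi : hyperltl1_FG phi -> hyperltl1_FG (Forall pi phi)
| FG_body psi : ltl1_FG psi -> hyperltl1_FG (Body psi).

Definition forall2_exists_form (phi : hyperltl) : Prop :=
  exists (pi1 pi2 : nat) (taus : seq nat) (psi : ltl),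
    phi = Forall pi1 (Forall pi2 (foldr Exists (Body psi) taus)).

End HyperLTL.

Arguments Tt {AP}.

(* Mu-recursive functions, indexed by arity.  In [PrimRec] and [Mu] the
   recursion, resp. search, argument comes first. *)
Inductive murec : nat -> Type :=
| Zero : murec 0
| Succ : murec 1
| Proj n (i : 'I_n) : murec n
| Comp m n (f : murec m) (g : 'I_m -> murec n) : murec n
| PrimRec n (f : murec n) (g : murec n.+2) : murec n.+1
| Mu n (f : murec n.+1) : murec n.

(* [computes f v y]: the partial function f is defined at v with value y. *)
Fixpoint computes n (f : murec n) : n.-tuple nat -> nat -> Prop :=
  match f in murec n0 return n0.-tuple nat -> nat -> Prop with
  | Zero => fun _ y => y = 0
  | Succ => fun v y => y = (thead v).+1
  | Proj _ i => fun v y => y = tnth v i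
  | Comp m _ f g => fun v y =>
      exists w : m.-tuple nat,
        (forall i : 'I_m, computes (g i) v (tnth w i)) /\ computes f w y
  | PrimRec _ f g => fun v y =>
      exists s : nat -> nat,
        [/\ computes f (behead_tuple v) (s 0),
            forall k : nat, k < thead v ->
              computes g [tuple of k :: s k :: behead_tuple v] (s k.+1)
          & y = s (thead v)]
  | Mu _ f => fun v y =>
      computes f [tuple of y :: v] 0 /\
      forall z : nat, z < y ->
        exists w : nat, computes f [tuple of z :: v] w.+1
  end.

(* The decision problem with inputs {x | D x}, presented by their codes, and
   yes-instances {x | D x /\ P x}; the decision procedure is unconstrained on
   numbers that are not codes of inputs. *)
Definition decidable_problem (I : Type) (code : I -> nat) (D P : I -> Prop) :
    Prop :=
  exists f : murec 1, forall x : I, D x ->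
    (P x -> computes f [tuple code x] 1) /\
    (~ P x -> computes f [tuple code x] 0).

Definition pair_code (x y : nat) : nat := Cantor.to_nat (x, y).

Fixpoint ltl_code n (psi : ltl 'I_n) : nat :=
  match psi with
  | Tt => pair_code 0 0
  | Atom a pi => pair_code 1 (pair_code a pi)
  | Not psi1 => pair_code 2 (ltl_code psi1)
  | Or psi1 psi2 => pair_code 3 (pair_code (ltl_code psi1) (ltl_code psi2))
  | Next psi1 => pair_code 4 (ltl_code psi1)
  | Until psi1 psi2 => pair_code 5 (pair_code (ltl_code psi1) (ltl_code psi2))
  end.

Fixpoint hyperltl_code n (phi : hyperltl 'I_n) : nat :=
  match phi with
  | Exists pi phi1 => pair_code 0 (pair_code pi (hyperltl_code phi1))
  | Forall pi phi1 => pair_code 1 (pair_code pi (hyperltl_code phi1))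
  | Body psi => pair_code 2 (ltl_code psi)
  end.

(* The finite set of propositions is part of the input; up to renaming it is
   {0, ..., n - 1}. *)
Definition input : Type := {n : nat & hyperltl 'I_n}.

Definition input_code (x : input) : nat :=
  pair_code (tag x) (hyperltl_code (tagged x)).

Lemma pair_code_inj x y x' y' :
  pair_code x y = pair_code x' y' -> x = x' /\ y = y'.
Proof. by move=> /Cantor.to_nat_inj [-> ->]. Qed.

Lemma ltl_code_inj n : injective (@ltl_code n).
Proof.
elim=> [|a pi|p IHp|p IHp q IHq|p IHp|p IHp q IHq] [|a' pi'|p'|p' q'|p'|p' q'] //=;
  move=> /pair_code_inj[//] _ //.
- by move=> /pair_code_inj[/val_inj-> ->].
- by move=> /IHp->.
- by move=> /pair_code_inj[/IHp-> /IHq->].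
- by move=> /IHp->.
- by move=> /pair_code_inj[/IHp-> /IHq->].
Qed.

Lemma hyperltl_code_inj n : injective (@hyperltl_code n).
Proof.
elim=> [pi p IHp|pi p IHp|p] [pi' p'|pi' p'|p'] //=;
  move=> /pair_code_inj[//] _.
- by move=> /pair_code_inj[-> /IHp->].
- by move=> /pair_code_inj[-> /IHp->].
- by move=> /ltl_code_inj->.
Qed.

Lemma input_code_inj : injective input_code.
Proof.
move=> [n p] [n' p'] /pair_code_inj /= [En].
by case: _ / En p' => p' /hyperltl_code_inj->.
Qed.

(* Main.v *)
(* A trace stands for a fact "f(v) = y", where f is a subprogram of a fixed
   program g: a label read off at position 0 says which subprogram, and the
   components y, v_0, v_1, ... are numbers, represented by sets of positions.
   Equality of two such sets, ~F(xor), has temporal depth one.  The formula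
   says that every fact follows from other facts of the model by the rule of
   its subprogram, the rule's premises being the existential traces; the second
   universal trace serves to axiomatise zero and successor.  Numerals are chains
   of successor facts, so a standard input pins down all values that the program
   really computes, even in a model with junk facts.  Hence "g(m) = 0" yields a
   model consisting of the true facts, and "g(m) = 1" excludes every model of
   the formula that also contains a fact "g(m) = 0".
   For the contradiction, let f decide satisfiability, let K map m to the code
   of the instance built from the subformula with code m and the numeral m, and
   let g = f o K; take m to be the code of the subformula describing g. *)
Require Import Defs.
From mathcomp Require Import all_boot zify.
From Stdlib Require Import Classical_Prop FunctionalExtensionality PropExtensionality.
From Stdlib Require Cantor.

Set Implicit Arguments.
Unset Strict Implicit.
Unset Printing Implicit Defensive.

(** * Quantifier-free formulas over labelled tuples *)

Inductive qf : Type :=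
| Lab (v l : nat)
| Eq (v a w b : nat)
| Neg (p : qf)
| Disj (p q : qf).

Definition Conj p q := Neg (Disj (Neg p) (Neg q)).
Definition Imp p q := Neg (Conj p (Neg q)).
Definition Top := Eq 0 0 0 0.
Fixpoint All n (F : nat -> qf) :=
  if n is n'.+1 then Conj (F n') (All n' F) else Top.

Section Sat.
Variables (E D : Type) (lab : E -> nat -> Prop) (comp : E -> nat -> D).

(** Kept abstract because formulas are read in two structures: traces, with sets of positions as
    components, and true facts, with numbers. [lab] is a relation since nothing stops a trace from
    carrying several labels. *)
Fixpoint sat (e : nat -> E) (p : qf) : Prop :=
  match p with
  | Lab v l => lab (e v) l
  | Eq v a w b => comp (e v) a = comp (e w) b
  | Neg p => ~ sat e p
  | Disj p q => sat e p \/ sat e q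
  end.

Lemma sat_conj e p q : sat e (Conj p q) = (sat e p /\ sat e q).
Proof.
apply: propositional_extensionality => /=; split; last by case=> ? ? [].
by move=> H; split; apply: NNPP => K; apply: H; [left | right].
Qed.

Lemma sat_disj e p q : sat e (Disj p q) = (sat e p \/ sat e q).
Proof. by []. Qed.

Lemma sat_imp e p q : sat e (Imp p q) = (sat e p -> sat e q).
Proof.
rewrite -[LHS]/(~ sat e (Conj p (Neg q))) sat_conj.
apply: propositional_extensionality; split=> [H Hp|H [/H Hq]]; last by case.
by apply: NNPP => Hq; apply: H.
Qed.

Lemma sat_all e n F : sat e (All n F) = (forall j, j < n -> sat e (F j)).
Proof.
apply: propositional_extensionality; elim: n => [|n IHn] //.
rewrite [All _ _]/= sat_conj; split=> [[Hn /IHn H] j|H].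
  by rewrite ltnS leq_eqVlt => /orP[/eqP->|/H].
by split; [apply: H | apply/IHn => j jn; apply: H; apply: ltnW].
Qed.

End Sat.

Definition satE := (sat_conj, sat_imp, sat_disj, sat_all).

(** * Numerals in arbitrary models *)

Section Models.
Variables (E D : Type) (T : E -> Prop).
Variables (lab : E -> nat -> Prop) (comp : E -> nat -> D).

(* [d] is the k-th iterated successor of some zero of the model. *)
Fixpoint represents k (d : D) : Prop :=
  exists t, [/\ T t, comp t 1 = d &
    if k is k'.+1 then lab t 1 /\ represents k' (comp t 0) else lab t 0].

Definition numbers_ok := forall t u, T t -> T u -> lab t 1 ->
  (lab u 0 -> comp t 1 <> comp u 1) /\
  (lab u 1 -> comp t 1 = comp u 1 -> comp t 0 = comp u 0).

Hypothesis ok : numbers_ok.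

(** The trace witnessing that [d] is a number may differ from [t]; injectivity of successor carries
    the witness over to the predecessor named by [t]. *)
Lemma represents_succ k d : represents k d -> forall t, T t -> lab t 1 -> comp t 1 = d ->
  exists2 k', k = k'.+1 & represents k' (comp t 0).
Proof.
case: k => [|k] [u [Tu <- Lu]] t Tt Lt Et; first by case: (ok Tt Tu Lt) => /(_ Lu).
by exists k => //; case: Lu => Lu; case: (ok Tt Tu Lt) => _ /(_ Lu Et) ->.
Qed.

Lemma represents_zero k d : represents k d -> forall t, T t -> lab t 0 -> comp t 1 = d -> k = 0.
Proof.
case: k => [|k] [u [Tu <- Lu]] t Tt Lt Et //.
by case: Lu => Lu _; case: (ok Tu Tt Lu) => /(_ Lt) [].
Qed.

End Models.

(* The meaning of a label, as a relation over its components, and its rule.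
   Component 0 is the value and component i.+1 the i-th argument.  In a rule,
   variable 0 is the fact to be justified and variables from 3 on are premises;
   1 and 2 are reserved for the second universal trace and the goal fact. *)
Definition entry : Type := ((nat -> nat) -> Prop) * qf.
Definition entry0 : entry := (fun _ => False, Top).

Definition flab (x : nat * (nat -> nat)) l := x.1 = l.
Definition fcomp (x : nat * (nat -> nat)) a := x.2 a.

Definition fact (L : seq entry) (x : nat * (nat -> nat)) :=
  x.1 < size L /\ (nth entry0 L x.1).1 x.2.

Definition env (X : Type) (x y z : X) (w : nat -> X) v :=
  match v with 0 => x | 1 => y | 2 => z | v'.+3 => w v' end.

(* The family of all true facts is closed under justification. *)
Definition supported (L : seq entry) := forall x, fact L x ->
  exists w, (forall v, fact L (w v)) /\
    forall y z, sat flab fcomp (env x y z w) (nth entry0 L x.1).2.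

Definition justified (L : seq entry) E D (T : E -> Prop) lab (comp : E -> nat -> D) :=
  forall t k, T t -> k < size L -> lab t k ->
  exists e, [/\ e 0 = t, forall v, T (e v) & sat lab comp e (nth entry0 L k).2].

Definition args n (x : nat -> nat) : n.-tuple nat := [tuple x i.+1 | i < n].

Definition components (y : nat) n (v : n.-tuple nat) : nat -> nat := nth 0 (y :: v).

Lemma args_components n y (v : n.-tuple nat) : args n (components y v) = v.
Proof. by apply: eq_from_tnth => i; rewrite tnth_mktuple [RHS](tnth_nth 0). Qed.

(** Can be asked of models with junk facts, since it concerns only facts with standard arguments on
    which [R] has a value. *)
Definition sound_at n (R : n.-tuple nat -> nat -> Prop) (L : seq entry) k :=
  forall E D (T : E -> Prop) lab (comp : E -> nat -> D),
  numbers_ok T lab comp -> justified L T lab comp ->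
  forall t v y, T t -> lab t k ->
  (forall i : 'I_n, represents T lab comp (tnth v i) (comp t i.+1)) -> R v y ->
  represents T lab comp y (comp t 0).

Definition compiled n (R : n.-tuple nat -> nat -> Prop) L k :=
  [/\ k < size L, forall x, R (args n x) (x 0) -> (nth entry0 L k).1 x &
     sound_at R L k].

(* Labels 0 and 1 are zero and successor, with the number in component 1 and,
   for a successor, its predecessor in component 0. *)
Definition L0 : seq entry :=
  [:: (fun x => x 1 = 0, Top); (fun x => x 1 = (x 0).+1, Top)].

Definition has_numbers (L : seq entry) := exists L', L = L0 ++ L'.

Lemma fact_cat L L' x : fact L x -> fact (L ++ L') x.
Proof.
by case=> H1 H2; split; [rewrite size_cat ltn_addr | rewrite nth_cat H1].
Qed.

Lemma justified_cat L L' E D (T : E -> Prop) lab (comp : E -> nat -> D) :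
  justified (L ++ L') T lab comp -> justified L T lab comp.
Proof.
move=> H t k Tt kL Lt; have := H t k Tt _ Lt; rewrite nth_cat kL.
by apply; rewrite size_cat ltn_addr.
Qed.

Lemma compiled_cat n R L L' k : @compiled n R L k -> compiled R (L ++ L') k.
Proof.
case=> kL C S; split; first by rewrite size_cat ltn_addr.
  by rewrite nth_cat kL.
by move=> E D T lab comp N /justified_cat; apply: S.
Qed.

(* The new label is [size L]; rules may refer to it recursively. *)
Lemma extend n (R : n.-tuple nat -> nat -> Prop) r L :
  let L1 := L ++ [:: ((fun x => R (args n x) (x 0)) : _ -> Prop, r)] in
  supported L ->
  (forall x, R (args n x) (x 0) ->
     (forall v y, R v y -> fact L1 (size L, components y v)) ->
     exists s : seq (nat * (nat -> nat)),
       (forall i, i < size s -> fact L1 (nth (size L, x) s i)) /\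
       forall y z, sat flab fcomp (env (size L, x) y z (nth (size L, x) s)) r) ->
  (forall E D (T : E -> Prop) lab (comp : E -> nat -> D),
     numbers_ok T lab comp -> justified L T lab comp ->
     (forall t, T t -> lab t (size L) ->
        exists e, [/\ e 0 = t, forall v, T (e v) & sat lab comp e r]) ->
     forall t v y, T t -> lab t (size L) ->
     (forall i : 'I_n, represents T lab comp (tnth v i) (comp t i.+1)) -> R v y ->
     represents T lab comp y (comp t 0)) ->
  exists en k, supported (L ++ [:: en]) /\ compiled R (L ++ [:: en]) k.
Proof.
move=> L1 wfL complete sound; exists (fun x => R (args n x) (x 0), r), (size L); rewrite -/L1.
have nthL1 : nth entry0 L1 (size L) = (fun x => R (args n x) (x 0), r).
  by rewrite nth_cat ltnn subnn.
have szL1 : size L < size L1 by rewrite size_cat addn1.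
have self x : R (args n x) (x 0) -> fact L1 (size L, x).
  by move=> Rx; split=> //=; rewrite nthL1.
split; last first.
  split=> //; first by rewrite nthL1.
  move=> E D T lab comp N C; apply: sound N _ _; first exact: justified_cat C.
  by move=> t Tt Lt; case: (C _ _ Tt szL1 Lt) => e; rewrite nthL1; exists e.
move=> [k x] [/=]; rewrite size_cat addn1 ltnS leq_eqVlt.
case/orP=> [/eqP -> {k}|kL].
  rewrite nthL1 /= => Rx.
  have [|s [Hs Hsat]] := complete x Rx.
    by move=> v y Rv; apply: self; rewrite args_components.
  (* Variables beyond the listed premises take the default [(size L, x)], the justified fact itself,
     which is true. *)
  exists (nth (size L, x) s); split=> // v.
  by case: (ltnP v (size s)) => [/Hs|?] //; rewrite nth_default //; apply: self.
rewrite nth_cat kL => Rx; have [|w [Hw Hsat]] := wfL (k, x); first by split.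
by exists w; split=> // v; apply: fact_cat.
Qed.

(** * Compilation of mu-recursive functions into rules *)

Lemma nth_args n x j : j < n -> nth 0 (args n x) j = x j.+1.
Proof. by move=> jn; rewrite -(tnth_nth 0 _ (Ordinal jn)) tnth_mktuple. Qed.

Lemma behead_cons n (a : nat) (u : n.-tuple nat) : behead_tuple [tuple of a :: u] = u.
Proof. exact: val_inj. Qed.

Lemma computes_comp m n (f : murec m) (g : 'I_m -> murec n) v y :
  computes (Comp f g) v y =
  exists w, (forall i, computes (g i) v (tnth w i)) /\ computes f w y.
Proof. by []. Qed.

Lemma computes_primrec n (f : murec n) (g : murec n.+2) a (u : n.-tuple nat) y :
  computes (PrimRec f g) [tuple of a :: u] y =
  exists s : nat -> nat, [/\ computes f u (s 0),
    forall k, k < a -> computes g [tuple of [:: k, s k & u]] (s k.+1) & y = s a].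
Proof.
(* Rewriting with [behead_cons] directly fails: the tuple proofs depend on it. *)
suff H (v : n.+1.-tuple nat) b w : thead v = b -> behead_tuple v = w ->
    computes (PrimRec f g) v y = exists s : nat -> nat, [/\ computes f w (s 0),
      forall k, k < b -> computes g [tuple of [:: k, s k & w]] (s k.+1) & y = s b].
  exact: H (theadE _ _) (behead_cons _ _).
by move=> <- <-.
Qed.

Lemma computes_mu n (f : murec n.+1) v y :
  computes (Mu f) v y = (computes f [tuple of y :: v] 0 /\
    forall z, z < y -> exists w, computes f [tuple of z :: v] w.+1).
Proof. by []. Qed.

(** Starting from an arbitrary table lets subprograms be compiled one after another into a common
    table, with labels already assigned unchanged. *)
Definition compilable n (R : n.-tuple nat -> nat -> Prop) := forall L,
  supported L -> has_numbers L -> exists L' k, supported (L ++ L') /\ compiled R (L ++ L') k.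

Lemma has_numbers_cat L L' : has_numbers L -> has_numbers (L ++ L').
Proof. by case=> L'' ->; exists (L'' ++ L'); rewrite catA. Qed.

Lemma zero_fact L x : has_numbers L -> x 1 = 0 -> fact L (0, x).
Proof. by case=> L' -> /= ?. Qed.

Lemma succ_fact L x : has_numbers L -> x 1 = (x 0).+1 -> fact L (1, x).
Proof. by case=> L' -> /= ?. Qed.

Lemma compiled_fact n R L k v y : @compiled n R L k -> R v y -> fact L (k, components y v).
Proof. by case=> kL C _ Rv; split=> //=; apply: C; rewrite args_components. Qed.

Lemma compilable_zero : compilable (computes Zero).
Proof.
move=> L wfL nL.
have [||en [k wfc]] := @extend _ (computes Zero) (Conj (Lab 3 0) (Eq 0 0 3 1)) L wfL.
- move=> x x0 _; rewrite /= in x0; exists [:: (0, fun=> 0)]; split=> [[|//] _|y z].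
    by apply: fact_cat; apply: zero_fact.
  by rewrite satE /= /flab /fcomp /= x0.
- move=> E D T lab comp N C HT t v y Tt Lt _ ->.
  have [e [? Te]] := HT t Tt Lt; subst t; rewrite satE /= => -[L3 ->].
  by exists (e 3).
by exists [:: en], k.
Qed.

Lemma compilable_succ : compilable (computes Succ).
Proof.
move=> L wfL nL.
have [||en [k wfc]] := @extend _ (computes Succ)
  (Conj (Lab 3 1) (Conj (Eq 0 1 3 0) (Eq 0 0 3 1))) L wfL.
(* The function [fun i => x 1 + i] has [x 1] and its successor as components 0 and 1. *)
- move=> x x0 _; rewrite /= in x0; exists [:: (1, fun i => x 1 + i)]; split=> [[|//] _|y z].
    by apply: fact_cat; apply: succ_fact => //; rewrite addn0 addn1.
  rewrite !satE /= /flab /fcomp /= addn0 addn1; split=> //; split=> //.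
  by rewrite x0 /thead tnth_mktuple.
- move=> E D T lab comp N C HT t v y Tt Lt Hv ->.
  have [e [? Te]] := HT t Tt Lt; subst t; rewrite !satE /= => -[L3 [E1 ->]].
  exists (e 3); split=> //; split=> //; rewrite -E1; exact: (Hv ord0).
by exists [:: en], k.
Qed.

Lemma compilable_proj n (i : 'I_n) : compilable (computes (Proj i)).
Proof.
move=> L wfL nL.
have [||en [k wfc]] := @extend _ (computes (Proj i)) (Eq 0 0 0 i.+1) L wfL.
- move=> x x0 _; rewrite /= in x0; exists [::]; split=> // y z.
  by rewrite /= /fcomp /= x0 tnth_mktuple.
- move=> E D T lab comp N C HT t v y Tt Lt Hv ->.
  by have [e [? Te /= E0]] := HT t Tt Lt; subst t; rewrite E0; apply: Hv.
by exists [:: en], k.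
Qed.

Lemma compilable_family m n (R : 'I_m -> n.-tuple nat -> nat -> Prop) L :
  (forall i, compilable (R i)) -> supported L -> has_numbers L ->
  exists L' (ks : nat -> nat), supported (L ++ L') /\
    forall i : 'I_m, compiled (R i) (L ++ L') (ks i).
Proof.
move=> HR wfL nL.
suff /(_ m (leqnn m)) [L' [ks [wf' H]]] : forall j, j <= m ->
    exists L' (ks : nat -> nat), supported (L ++ L') /\
    forall i : 'I_m, i < j -> compiled (R i) (L ++ L') (ks i).
  by exists L', ks; split=> // i; apply: H.
elim=> [|j IHj] jm.
  by exists [::], id; rewrite cats0.
have [L' [ks [wf' H]]] := IHj (ltnW jm).
have [L2 [k [wf2 c]]] := HR (Ordinal jm) _ wf' (has_numbers_cat L' nL).
exists (L' ++ L2), (fun i => if i == j then k else ks i); rewrite catA; split=> // i.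
rewrite ltnS leq_eqVlt; case: eqVneq => /= [ij _|_ /H]; last exact: compiled_cat.
by rewrite (_ : i = Ordinal jm) //; apply: val_inj.
Qed.

(** Variable 3 is the fact of the outer function, variable i + 4 that of the i-th inner one. *)
Definition comp_rule m n kf (ks : nat -> nat) :=
  Conj (Conj (Lab 3 kf) (Eq 0 0 3 0))
    (All m (fun i => Conj (Conj (Lab i.+4 (ks i)) (Eq 3 i.+1 i.+4 0))
       (All n (fun j => Eq i.+4 j.+1 0 j.+1)))).

Lemma compilable_comp m n (f : murec m) (g : 'I_m -> murec n) :
  compilable (computes f) -> (forall i, compilable (computes (g i))) ->
  compilable (computes (Comp f g)).
Proof.
move=> Hf Hg L wfL nL.
have [L1 [ks [wf1 cg]]] := compilable_family Hg wfL nL.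
have [L2 [kf [wf2 cf]]] := Hf _ wf1 (has_numbers_cat L1 nL).
have {}cg i := compiled_cat L2 (cg i).
move: wf2 cf cg; rewrite -catA; move: (L1 ++ L2) => L' wf' cf cg.
have [||en [k wfc]] := @extend _ (computes (Comp f g)) (comp_rule m n kf ks) (L ++ L') wf'.
- move=> x; rewrite computes_comp => -[w [Hw Fw]] _.
  exists ((kf, components (x 0) w) ::
    mkseq (fun i => (ks i, components (nth 0 w i) (args n x))) m); split.
    case=> [_|i]; first by apply: fact_cat; exact: compiled_fact cf Fw.
    rewrite /= size_mkseq ltnS => im; rewrite nth_mkseq //; apply: fact_cat.
    by have := compiled_fact (cg _) (Hw (Ordinal im)); rewrite (tnth_nth 0).
  move=> y z; rewrite /comp_rule !satE; split=> // i im.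
  rewrite !satE /= /flab /fcomp !(nth_map 0) ?size_iota // nth_iota //=; split=> // j jn.
  by rewrite /components /= nth_args.
- move=> E D T lab comp N C HT t v y Tt Lt Hv; rewrite computes_comp => -[w [Hw Fw]].
  have [e [? Te]] := HT t Tt Lt; subst t.
  rewrite /comp_rule !satE => -[[L3 E3] H]; rewrite /= in E3; rewrite E3.
  case: cf => _ _ cf; apply: (cf E D T lab comp N C _ w) => // i.
  have := H i (ltn_ord i); cbv beta; rewrite !satE /= => -[[Li ->] Hi].
  case: (cg i) => _ _ {}cg; apply: (cg E D T lab comp N C _ v) => // j.
  by have /= -> := Hi j (ltn_ord j).
by exists (L' ++ [:: en]), k; rewrite catA.
Qed.

Lemma args_cons n x : args n.+1 x = [tuple of x 1 :: args n (fun j => x j.+1)].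
Proof.
apply: eq_from_tnth => i; rewrite tnth_mktuple (tnth_nth 0).
by case: i => [[|i] Hi] //; rewrite -[RHS]/(nth 0 (args n _) i) nth_args.
Qed.

(** Variable 3 certifies that the recursion argument is zero; variable 4 is the fact of the base
    function. *)
Definition primrec_zero_rule n kf :=
  Conj (Conj (Lab 3 0) (Eq 0 1 3 1))
    (Conj (Conj (Lab 4 kf) (Eq 0 0 4 0)) (All n (fun j => Eq 4 j.+1 0 j.+2))).

(** Variable 3 names the predecessor of the recursion argument, variable 4 is the recursive call
    there, and variable 5 applies the step function. *)
Definition primrec_succ_rule n kg self :=
  Conj (Conj (Lab 3 1) (Eq 0 1 3 1))
    (Conj (Conj (Conj (Lab 4 self) (Eq 4 1 3 0)) (All n (fun j => Eq 4 j.+2 0 j.+2)))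
      (Conj (Conj (Conj (Lab 5 kg) (Eq 0 0 5 0)) (Conj (Eq 5 1 3 0) (Eq 5 2 4 0)))
        (All n (fun j => Eq 5 j.+3 0 j.+2)))).

Lemma compilable_primrec n (f : murec n) (g : murec n.+2) :
  compilable (computes f) -> compilable (computes g) ->
  compilable (computes (PrimRec f g)).
Proof.
move=> Hf Hg L wfL nL.
have [L1 [kf [wf1 cf]]] := Hf _ wfL nL.
have [L2 [kg [wf2 cg]]] := Hg _ wf1 (has_numbers_cat L1 nL).
have {}cf := compiled_cat L2 cf.
move: wf2 cf cg; rewrite -catA; move: (L1 ++ L2) => L' wf' cf cg.
have nL' := has_numbers_cat L' nL.
have [||en [k wfc]] := @extend _ (computes (PrimRec f g))
  (Disj (primrec_zero_rule n kf) (primrec_succ_rule n kg (size (L ++ L')))) (L ++ L') wf'.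
- move=> x Rx self.
  move: Rx; rewrite args_cons computes_primrec => -[s [Hf0 Hs x0]].
  case x1: (x 1) => [|k].
    exists [:: (0, fun=> 0); (kf, components (s 0) (args n (fun j => x j.+1)))]; split.
      case=> [|[|//]] _; apply: fact_cat; first exact: zero_fact.
      exact: compiled_fact cf Hf0.
    move=> y z; left; rewrite /primrec_zero_rule !satE /= /flab /fcomp /= x0 x1.
    by do !split=> //; move=> j jn; apply: (nth_args _ jn).
  set v := args n _ in Hf0 Hs.
  exists [:: (1, fun i => k + i); (size (L ++ L'), components (s k) [tuple of k :: v]);
     (kg, components (x 0) [tuple of [:: k, s k & v]])]; split.
    case=> [|[|[|//]]] _.
    + by apply: fact_cat; apply: succ_fact => //; rewrite addn0 addn1.
    + apply: self; rewrite computes_primrec; exists s; split=> // i ik.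
      by apply: Hs; rewrite x1 ltnS ltnW.
    + apply: fact_cat; apply: compiled_fact cg _; rewrite x0 x1.
      by apply: Hs; rewrite x1.
  move=> y z; right; rewrite /primrec_succ_rule !satE /= /flab /fcomp /= x1 addn0 addn1.
  by do !split=> //; move=> j jn; apply: (nth_args (fun j => x j.+1) jn).
- move=> E D T lab comp N C HT t v y Tt Lt Hv.
  case/tupleP: v Hv => a u Hv; rewrite computes_primrec => -[s [Hf0 Hs ->]].
  have {}Hu (i : nat) (iu : i < n) : represents T lab comp (nth 0 u i) (comp t i.+2).
    have := Hv (lift ord0 (Ordinal iu)).
    by rewrite (tnth_nth 0) /= /bump /=.
  have {Hv} := Hv ord0; rewrite tnth0.
  (* Induction on the standard recursion argument [b], for all facts [t]; the bound [b <= a] keeps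
     the steps of [s] available. *)
  have: a <= a by []; move: {1 3 4}a => b; elim: b => [|b IHb] in t Tt Lt Hu *.
    move=> _ Hb; have [e [? Te]] := HT t Tt Lt; subst t.
    rewrite /primrec_zero_rule /primrec_succ_rule !satE /=; case=> -[[L3 E3]].
      case=> -[L4 ->] H; case: cf => _ _ cf.
      apply: (cf _ _ _ _ _ N C _ u) => // i; have /= -> := H i (ltn_ord i).
      by rewrite (tnth_nth 0); apply: Hu.
    by have [] // := represents_succ N Hb (Te 3) L3.
  move=> ba Hb; have [e [? Te]] := HT t Tt Lt; subst t.
  rewrite /primrec_zero_rule /primrec_succ_rule !satE /=; case=> -[[L3 E3]].
    by have := represents_zero N Hb (Te 3) L3 (esym E3).
  case=> -[[L4 E4] H4] [[[L5 ->] [E51 E52]] H5].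
  have [_ [<-] Hb'] := represents_succ N Hb (Te 3) L3 (esym E3).
  have IH : represents T lab comp (s b) (comp (e 4) 0).
    apply: IHb => //; [move=> i iu|exact: ltnW|by rewrite E4].
    by have /= -> := H4 i iu; apply: Hu.
  case: cg => _ _ cg.
  apply: (cg _ _ _ _ _ N C _ [tuple of [:: b, s b & u]]) => //; last exact: Hs.
  case=> -[|[|i]] Hi; rewrite (tnth_nth 0) /=; [by rewrite E51 | by rewrite E52 |].
  by have /= -> := H5 i Hi; apply: Hu.
by exists (L' ++ [:: en]), k; rewrite catA.
Qed.

(* Minimisation searches upwards from 0: by induction on the distance to the
   actual minimum, even a nonstandard model must stop there.  A downward
   recursion from the claimed value could descend forever. *)
Definition search n (R : n.+1.-tuple nat -> nat -> Prop) (v : n.+1.-tuple nat) y :=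
  [/\ thead v <= y, R [tuple of y :: behead_tuple v] 0 &
    forall z, thead v <= z < y -> exists w, R [tuple of z :: behead_tuple v] w.+1].

Lemma search_cons n (R : n.+1.-tuple nat -> nat -> Prop) a (u : n.-tuple nat) y :
  search R [tuple of a :: u] y = [/\ a <= y, R [tuple of y :: u] 0 &
    forall z, a <= z < y -> exists w, R [tuple of z :: u] w.+1].
Proof.
suff H (v : n.+1.-tuple nat) b w : thead v = b -> behead_tuple v = w ->
    search R v y = [/\ b <= y, R [tuple of y :: w] 0 &
      forall z, b <= z < y -> exists x, R [tuple of z :: w] x.+1].
  exact: H (theadE _ _) (behead_cons _ _).
by move=> <- <-.
Qed.

(** Variable 3 is the fact at the current candidate. Variable 4 shows its value to be zero, and the
    candidate is the answer, or a successor; then variable 5 yields the next candidate and variable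
    6 the search from there. *)
Definition search_rule n kf self :=
  Conj (Conj (Lab 3 kf) (All n.+1 (fun j => Eq 3 j.+1 0 j.+1)))
    (Disj (Conj (Conj (Lab 4 0) (Eq 3 0 4 1)) (Eq 0 0 0 1))
      (Conj (Conj (Lab 4 1) (Eq 3 0 4 1)) (Conj (Conj (Lab 5 1) (Eq 0 1 5 0))
        (Conj (Conj (Lab 6 self) (Eq 6 1 5 1))
           (Conj (Eq 0 0 6 0) (All n (fun j => Eq 6 j.+2 0 j.+2))))))).

Lemma compilable_search n (R : n.+1.-tuple nat -> nat -> Prop) :
  compilable R -> compilable (search R).
Proof.
move=> Hf L wfL nL.
have [L' [kf [wf' cf]]] := Hf _ wfL nL.
have nL' := has_numbers_cat L' nL.
have [||en [k wfc]] := @extend _ (search R) (search_rule n kf (size (L ++ L'))) (L ++ L') wf'.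
- move=> x Rx self.
  move: Rx; rewrite args_cons search_cons => -[].
  set v := args n _ => le0 R0 Rw.
  have: exists w, R [tuple of x 1 :: v] w /\ (x 0 = x 1 /\ w = 0 \/ x 1 < x 0 /\ 0 < w).
    move: le0; rewrite leq_eqVlt => /orP[/eqP E|lt].
      by exists 0; rewrite E; split=> //; left.
    have [|w Hw] := Rw (x 1); first by rewrite leqnn.
    by exists w.+1; split=> //; right.
  case=> w [Hw Hcase].
  have F3 : fact (L ++ L') (kf, components w [tuple of x 1 :: v]) by exact: compiled_fact cf Hw.
  have E3 j : j < n.+1 -> components w [tuple of x 1 :: v] j.+1 = x j.+1.
    by case: j => [|j] // jn; apply: (nth_args _ (jn : j < n)).
  case: Hcase => -[H0 H1].
    exists [:: (kf, components w [tuple of x 1 :: v]); (0, fun=> 0)]; split.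
      by case=> [|[|//]] _; apply: fact_cat => //; apply: zero_fact.
    move=> y z; rewrite /search_rule !satE /= /flab /fcomp /=.
    split; first by split=> // j jn; apply: E3.
    by left.
  (* As [w] is positive, [fun i => w.-1 + i] exhibits it as a successor. *)
  exists [:: (kf, components w [tuple of x 1 :: v]); (1, fun i => w.-1 + i);
    (1, fun i => x 1 + i); (size (L ++ L'), components (x 0) [tuple of (x 1).+1 :: v])]; split.
    case=> [|[|[|[|//]]]] _; [exact: fact_cat | | |].
    + by apply: fact_cat; apply: succ_fact; rewrite // addn0 addn1.
    + by apply: fact_cat; apply: succ_fact; rewrite // addn0 addn1.
    + apply: self; rewrite search_cons; split=> // z /andP[z1 z2].
      by apply: Rw; rewrite ltnW.
  move=> y z; rewrite /search_rule !satE /= /flab /fcomp /=.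
  split; first by split=> // j jn; apply: E3.
  right; rewrite addn0 !addn1 prednK //.
  by do !split=> //; move=> j jn; apply: (nth_args (fun j => x j.+1) jn).
- move=> E D T lab comp N C HT t v y Tt Lt Hv.
  case/tupleP: v Hv => a u Hv; rewrite search_cons => -[le0 R0 Rw].
  have {}Hu (i : nat) (iu : i < n) : represents T lab comp (nth 0 u i) (comp t i.+2).
    have := Hv (lift ord0 (Ordinal iu)).
    by rewrite (tnth_nth 0) /= /bump /=.
  have {Hv} := Hv ord0; rewrite tnth0 => Ha.
  have [d Ed] : exists d, y = a + d by exists (y - a); rewrite subnKC.
  elim: d => [|d IHd] in t Tt Lt Hu a Ha le0 Rw Ed *.
    have [e [? Te]] := HT t Tt Lt; subst t.
    rewrite /search_rule !satE => -[[L3 H3] H].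
    have: represents T lab comp 0 (comp (e 3) 0).
      case: cf => _ _ cf.
      apply: (cf _ _ _ _ _ N C _ [tuple of y :: u]) => // i.
      have /= -> := H3 i (ltn_ord i).
      case: i => -[|i] Hi; rewrite (tnth_nth 0) /=; first by rewrite Ed addn0.
      exact: Hu.
    case: H => -[[L4 E4]] H R3.
      by rewrite H Ed addn0.
    by have [] // := represents_succ N R3 (Te 4) L4.
  have [e [? Te]] := HT t Tt Lt; subst t.
  rewrite /search_rule !satE => -[[L3 H3] H].
  have [|w Rw'] := Rw a; first by rewrite Ed leqnn addnS ltnS leq_addr.
  have: represents T lab comp w.+1 (comp (e 3) 0).
    case: cf => _ _ cf.
    apply: (cf _ _ _ _ _ N C _ [tuple of a :: u]) => // i.
    have /= -> := H3 i (ltn_ord i).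
    by case: i => -[|i] Hi; rewrite (tnth_nth 0) //=; apply: Hu.
  case: H => -[[L4 E4]] H R3.
    by have := represents_zero N R3 (Te 4) L4 (esym E4).
  case: H => -[L5 E5] [[L6 E6] [-> H6]].
  apply: (IHd _ _ _ _ a.+1) => //.
  + by move=> i iu; have /= -> := H6 i iu; apply: Hu.
  + by rewrite E6; exists (e 5); split=> //; rewrite -E5.
  + by rewrite Ed addnS ltnS leq_addr.
  + by move=> z /andP[z1 z2]; apply: Rw; rewrite ltnW.
  + by rewrite Ed addnS.
by exists (L' ++ [:: en]), k; rewrite catA.
Qed.

Definition mu_rule n ks :=
  Conj (Conj (Lab 3 0) (Lab 4 ks))
    (Conj (Conj (Eq 0 0 4 0) (Eq 4 1 3 1)) (All n (fun j => Eq 4 j.+2 0 j.+1))).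

Lemma compilable_mu n (f : murec n.+1) :
  compilable (computes f) -> compilable (computes (Mu f)).
Proof.
move=> /compilable_search Hf L wfL nL.
have [L' [ks [wf' cf]]] := Hf _ wfL nL.
have nL' := has_numbers_cat L' nL.
have [||en [k wfc]] := @extend _ (computes (Mu f)) (mu_rule n ks) (L ++ L') wf'.
- move=> x; rewrite computes_mu => -[R0 Rw] _.
  exists [:: (0, fun=> 0); (ks, components (x 0) [tuple of 0 :: args n x])]; split.
    case=> [|[|//]] _; apply: fact_cat; first exact: zero_fact.
    by apply: compiled_fact cf _; rewrite search_cons.
  move=> y z; rewrite /mu_rule !satE /= /flab /fcomp /=.
  by do !split=> //; move=> j jn; apply: (nth_args _ jn).
- move=> E D T lab comp N C HT t v y Tt Lt Hv; rewrite computes_mu => -[R0 Rw].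
  have [e [? Te]] := HT t Tt Lt; subst t.
  rewrite /mu_rule !satE /= => -[[L3 L4] [[-> E4] H4]].
  case: cf => _ _ cf.
  apply: (cf _ _ _ _ _ N C _ [tuple of 0 :: v]) => //.
    case=> -[|i] Hi; rewrite (tnth_nth 0) /=; first by exists (e 3).
    have /= -> := H4 i Hi; have := Hv (Ordinal (Hi : i < n)).
    by rewrite (tnth_nth 0).
  by rewrite search_cons.
by exists (L' ++ [:: en]), k; rewrite catA.
Qed.

Lemma compilableP n (f : murec n) : compilable (computes f).
Proof.
elim: f => {n}.
- exact: compilable_zero.
- exact: compilable_succ.
- exact: compilable_proj.
- by move=> m n f Hf g Hg; apply: compilable_comp.
- by move=> n f Hf g Hg; apply: compilable_primrec.
- by move=> n f Hf; apply: compilable_mu.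
Qed.

(** * Translation to HyperLTL *)

Definition cAtom a v := pair_code 1 (pair_code a v).
Definition cNot x := pair_code 2 x.
Definition cOr x y := pair_code 3 (pair_code x y).
Definition cXor x y := cOr (cNot (cOr (cNot x) y)) (cNot (cOr x (cNot y))).
Definition cConj x y := cNot (cOr (cNot x) (cNot y)).
Definition cEq v a w b :=
  cNot (pair_code 5 (pair_code (pair_code 0 0) (cXor (cAtom a.*2 v) (cAtom b.*2 w)))).

(** Independent of the number of propositions, which will itself be chosen from this code;
    [ltl_code_translate] gives the agreement once the bounds hold. *)
Fixpoint code (p : qf) : nat :=
  match p with
  | Lab v l => cAtom l.*2.+1 v
  | Eq v a w b => cEq v a w b
  | Neg p => cNot (code p)
  | Disj p q => cOr (code p) (code q)
  end.

Fixpoint bounded N M (p : qf) : bool :=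
  match p with
  | Lab v l => (l.*2.+1 <= N) && (v < M)
  | Eq v a w b => [&& a.*2 <= N, v < M, b.*2 <= N & w < M]
  | Neg p => bounded N M p
  | Disj p q => bounded N M p && bounded N M q
  end.

Lemma bounded_leq N M M' p : M <= M' -> bounded N M p -> bounded N M' p.
Proof.
move=> le; elim: p => [v l|v a w b|p IHp|p IHp q IHq] //=; last by case/andP=> /IHp-> /IHq.
  by case/andP=> ->; lia.
by case/and4P=> -> ? ->; lia.
Qed.

Lemma leq_pair_code x y : x <= pair_code x y /\ y <= pair_code x y.
Proof. by have := Cantor.to_nat_non_decreasing x y; rewrite /pair_code; lia. Qed.

Lemma leq_cAtom a v : a <= cAtom a v /\ v <= cAtom a v.
Proof.
have := leq_pair_code 1 (pair_code a v); have := leq_pair_code a v.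
by rewrite -/(cAtom a v); lia.
Qed.

Lemma leq_cNot x : x <= cNot x.
Proof. by case: (leq_pair_code 2 x). Qed.

Lemma leq_cOr x y : x <= cOr x y /\ y <= cOr x y.
Proof.
have := leq_pair_code 3 (pair_code x y); have := leq_pair_code x y.
by rewrite -/(cOr x y); lia.
Qed.

Lemma leq_cXor x y : x <= cXor x y /\ y <= cXor x y.
Proof.
rewrite /cXor; set u := cOr x _; have := leq_cOr (cNot (cOr (cNot x) y)) (cNot u).
by have := leq_cOr x (cNot y); have := leq_cNot y; have := leq_cNot u; lia.
Qed.

Lemma leq_cEq v a w b :
  cAtom a.*2 v <= cEq v a w b /\ cAtom b.*2 w <= cEq v a w b.
Proof.
rewrite /cEq; set x := cXor _ _; set y := pair_code _ x; set z := pair_code 5 y.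
have : x <= cNot z.
  have := leq_pair_code (pair_code 0 0) x; have := leq_pair_code 5 y.
  by have := leq_cNot z; rewrite -/y -/z; lia.
by have := leq_cXor (cAtom a.*2 v) (cAtom b.*2 w); rewrite -/x; lia.
Qed.

(** Cantor pairing is at least each of its arguments, so no index in [p] exceeds the code. *)
Lemma bounded_code N p : code p <= N -> bounded N N.+1 p.
Proof.
elim: p => [v l|v a w b|p IHp|p IHp q IHq] /=.
- by have := leq_cAtom l.*2.+1 v; lia.
- have := leq_cAtom a.*2 v; have := leq_cAtom b.*2 w.
  by have := leq_cEq v a w b; lia.
- by move=> H; apply: IHp; have := leq_cNot (code p); lia.
- by have := leq_cOr (code p) (code q) => ? ?; rewrite IHp ?IHq //; lia.
Qed.

(* Component a is the proposition 2a, label l the proposition 2l + 1. *)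
Section Translation.
Variable N : nat.

Definition xor (p q : ltl 'I_N.+1) := Or (Not (Or (Not p) q)) (Not (Or p (Not q))).

Fixpoint translate (p : qf) : ltl 'I_N.+1 :=
  match p with
  | Lab v l => Atom (inord l.*2.+1) v
  | Eq v a w b => Not (Finally (xor (Atom (inord a.*2) v) (Atom (inord b.*2) w)))
  | Neg p => Not (translate p)
  | Disj p q => Or (translate p) (translate q)
  end.

Lemma ltl_code_translate M p : bounded N M p -> ltl_code (translate p) = code p.
Proof.
elim: p => [v l|v a w b|p IHp|p IHp q IHq] //=.
- by case/andP=> ? _; rewrite inordK.
- by case/and4P=> ? _ ? _; rewrite !inordK.
- by move/IHp->.
- by case/andP=> /IHp-> /IHq->.
Qed.

Lemma ltl1_FG_translate p : ltl1_FG (translate p).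
Proof.
elim: p => [v l|v a w b|p IHp|p IHp q IHq] /=.
- exact/FG_prop/prop_atom.
- apply/FG_not/FG_finally/prop_or; apply/prop_not/prop_or;
  by repeat (apply: prop_not || apply: prop_atom).
- exact: FG_not.
- exact: FG_or.
Qed.

Lemma fv_translate M p : bounded N M p -> all (fun v => v < M) (fv_ltl (translate p)).
Proof.
elim: p => [v l|v a w b|p IHp|p IHp q IHq] //=.
- by case/andP=> _ ->.
- by case/and4P=> _ -> _ ->.
- by case/andP=> /IHp p' /IHq q'; rewrite all_cat p'.
Qed.

Definition tlab (t : trace 'I_N.+1) l : Prop := inord l.*2.+1 \in t 0.
Definition tcomp (t : trace 'I_N.+1) a : nat -> bool := fun i => inord a.*2 \in t i.

Lemma ltl_sat_translate M (Pi : assignment 'I_N.+1) e p : bounded N M p ->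
  (forall v, v < M -> Pi v = Some (e v)) ->
  ltl_sat Pi (translate p) <-> sat tlab tcomp e p.
Proof.
move=> + HPi; elim: p => [v l|v a w b|p IHp|p IHp q IHq] /=.
- by case/andP=> _ vM; rewrite HPi.
- case/and4P=> _ vM _ wM.
  have xorE j : ltl_sat (shift j Pi) (xor (Atom (inord a.*2) v) (Atom (inord b.*2) w))
      <-> tcomp (e v) a j <> tcomp (e w) b j.
    rewrite /= /shift !HPi //= /Defs.suffix addn0 -!/(tcomp _ _ _).
    case: (tcomp _ _ _); case: (tcomp _ _ _); split=> //; try by tauto.
    + by move=> _; left=> -[].
    + by move=> _; right=> -[].
  split=> [H|H [j []]]; last by move=> /xorE; rewrite H.
  apply: functional_extensionality => j.
  case: (eqVneq (tcomp (e v) a j) (tcomp (e w) b j)) => // /eqP ne.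
  by case: H; exists j; split=> //; apply/xorE.
- by move/IHp; tauto.
- by case/andP=> /IHp ? /IHq; tauto.
Qed.

(** A number becomes the singleton of a position, and the label holds at every position. *)
Definition trace_of (x : nat * (nat -> nat)) : trace 'I_N.+1 :=
  fun i => [set a : 'I_N.+1 | if odd a then a./2 == x.1 else x.2 a./2 == i].

Lemma sat_trace_of M e p : bounded N M p ->
  sat tlab tcomp (fun v => trace_of (e v)) p <-> sat flab fcomp e p.
Proof.
have tcompE x a i : a.*2 <= N -> tcomp (trace_of x) a i = (x.2 a == i).
  by move=> aN; rewrite /tcomp inE inordK // odd_double doubleK.
elim: p => [v l|v a w b|p IHp|p IHp q IHq] /=.
- case/andP=> lN _; rewrite /tlab inE inordK //= odd_double /= uphalf_double eq_sym.
  by rewrite /flab; split=> /eqP.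
- case/and4P=> aN _ bN _; rewrite /fcomp; split=> [H|H].
    (* Two equal singletons are compared at the element of the first. *)
    have := congr1 (fun f => f ((e v).2 a)) H.
    by rewrite /= !tcompE // eqxx => /esym/eqP.
  by apply: functional_extensionality => j; rewrite !tcompE // H.
- by move/IHp; tauto.
- by case/andP=> /IHp ? /IHq; tauto.
Qed.

End Translation.

Lemma sat_ext E D lab (comp : E -> nat -> D) N M e e' p : bounded N M p ->
  (forall v, v < M -> e v = e' v) -> sat lab comp e p -> sat lab comp e' p.
Proof.
move=> + He; suff H : bounded N M p -> sat lab comp e p <-> sat lab comp e' p.
  by move=> /H ->.
elim: p => [v l|v a w b|p IHp|p IHp q IHq] /=.
- by case/andP=> _ /He->.
- by case/and4P=> _ /He-> _ /He->.
- by move/IHp; tauto.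
- by case/andP=> /IHp ? /IHq; tauto.
Qed.

(** Even with repeated variables one simultaneous choice [e] suffices, as the innermost quantifier
    decides. *)
Lemma sat_prefix (AP : finType) (T : trace AP -> Prop) Pi taus psi :
  hyperltl_sat T Pi (foldr (@Exists AP) (Body psi) taus) <->
  exists e, (forall v, v \in taus -> T (e v)) /\
    ltl_sat (fun v => if v \in taus then Some (e v) else Pi v) psi.
Proof.
elim: taus Pi => [|pi taus IH] Pi /=.
  by split=> [H|[e [_ H]]] //; exists (fun _ _ => set0); split.
split=> [[t [Tt /IH[e [He H]]]]|[e [He H]]].
  exists (fun v => if v \in taus then e v else t); split=> [v|].
    by case: ifP => [/He|].
  congr (ltl_sat _ psi): H; apply: functional_extensionality => v.
  by rewrite inE /update; case: (v \in taus); case: eqP.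
exists (e pi); split; first by apply: He; rewrite inE eqxx.
apply/IH; exists e; split=> [v vt|]; first by apply: He; rewrite inE vt orbT.
congr (ltl_sat _ psi): H; apply: functional_extensionality => v.
by rewrite inE /update; case: (v \in taus); case: eqP => // ->.
Qed.

Fixpoint taus k := if k is k'.+1 then k'.+2 :: taus k' else [::].

Lemma mem_taus k v : (v \in taus k) = (1 < v < k.+2).
Proof.
elim: k => [|k IHk] /=; first by rewrite in_nil; case: v => [|[]].
by rewrite inE IHk; lia.
Qed.

Definition forall2 N k (p : qf) : hyperltl 'I_N.+1 :=
  Forall 0 (Forall 1 (foldr (@Exists _) (Body (translate N p)) (taus k))).

Lemma models_forall2 N k p (T : trace 'I_N.+1 -> Prop) : bounded N k.+2 p ->
  models T (forall2 N k p) <-> forall x y, T x -> T y ->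
    exists e, [/\ e 0 = x, e 1 = y, forall v, T (e v) & sat (@tlab N) (@tcomp N) e p].
Proof.
move=> bp; rewrite /models /=; split=> H x.
  move=> y Tx Ty; have /sat_prefix[e [Te He]] := H x Tx y Ty.
  (* Variables outside the prefix are sent to [x], so that [e] stays in [T]. *)
  exists (fun v => if v \in taus k then e v else if v == 1 then y else x).
  split; rewrite ?mem_taus //.
    by move=> v; case: ifP => [/Te|_] //; case: ifP.
  apply: (iffLR (ltl_sat_translate bp _)) He.
  move=> v vk; rewrite /update mem_taus.
  by case: v vk => [|[|v]] //= ->.
move=> Tx y Ty; have [e [E0 E1 Te He]] := H x y Tx Ty.
apply/sat_prefix; exists e; split=> [v _|]; first exact: Te.
apply: (iffRL (ltl_sat_translate bp _)) He.
move=> v vk; rewrite /update mem_taus.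
by case: v vk => [|[|v]] vk; rewrite /= ?vk ?E0 ?E1.
Qed.

Lemma sentence_forall2 N k p : bounded N k.+2 p -> sentence (forall2 N k p).
Proof.
move=> /fv_translate/allP H; rewrite /sentence /=.
have fvE s : fv (foldr (@Exists _) (Body (translate N p)) s) =
    [seq v <- fv_ltl (translate N p) | v \notin s].
  elim: s => [|a s IHs] /=; first by rewrite filter_predT.
  by rewrite IHs -filter_predI; apply: eq_filter => v; rewrite /= inE negb_or.
rewrite fvE -!filter_predI -(filter_pred0 (fv_ltl (translate N p))).
by apply: eq_in_filter => v /H vk; rewrite /= mem_taus; lia.
Qed.

Lemma forall2_form N k p : forall2_exists_form (forall2 N k p).
Proof. by exists 0, 1, (taus k), (translate N p). Qed.

Lemma hyperltl1_FG_forall2 N k p : hyperltl1_FG (forall2 N k p).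
Proof.
apply/FG_forall/FG_forall; elim: (taus k) => [|v s IHs] /=; last exact: FG_exists.
exact/FG_body/ltl1_FG_translate.
Qed.

(** * Computability of the reduction *)

Opaque pair_code.

Definition computable n (F : seq nat -> nat) :=
  exists f : murec n, forall v : n.-tuple nat, computes f v (F v).

Lemma computable_ext n F G : F =1 G -> computable n F -> computable n G.
Proof. by move=> FG [f Hf]; exists f => v; rewrite -FG. Qed.

Lemma computable_nth n i : i < n -> computable n (fun v => nth 0 v i).
Proof. by move=> lt; exists (Proj (Ordinal lt)) => v /=; rewrite (tnth_nth 0). Qed.

Lemma computable_comp m n F (G : nat -> seq nat -> nat) :
  computable m F -> (forall i, i < m -> computable n (G i)) ->
  computable n (fun v => F (mkseq (fun i => G i v) m)).
Proof.
case=> f Hf HG.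
have [g Hg] := fin_all_exists (fun i : 'I_m => HG i (ltn_ord i)).
exists (Comp f g) => v.
have sz : size (mkseq (fun i => G i v) m) == m by rewrite size_mkseq.
exists (Tuple sz); split; last exact: Hf.
by move=> i; rewrite (tnth_nth 0) /= nth_mkseq.
Qed.

Lemma computable_succ n F : computable n F -> computable n (fun v => (F v).+1).
Proof.
move=> HF; apply: (@computable_comp 1 n (fun v => (head 0 v).+1) (fun _ => F)) => //.
by exists Succ => v /=; case/tupleP: v => a u; rewrite theadE.
Qed.

Lemma computable_const n c : computable n (fun=> c).
Proof.
elim: c => [|c]; last exact: computable_succ.
by apply: (@computable_comp 0 n (fun=> 0) (fun _ => head 0)) => //; exists Zero.
Qed.

Lemma computable_rec n K b s : computable n K -> computable n b -> computable n.+2 s ->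
  computable n (fun v => nat_rec (fun=> nat) (b v) (fun k r => s [:: k, r & v]) (K v)).
Proof.
move=> HK [f Hf] [g Hg].
pose F v := nat_rec (fun=> nat) (b (behead v))
  (fun k r => s [:: k, r & behead v]) (head 0 v).
have HF : computable n.+1 F.
  exists (PrimRec f g) => v; case/tupleP: v => a u; rewrite computes_primrec.
  by exists (fun k => F (k :: u)).
have [h Hh] : computable n (fun v =>
    F (mkseq (fun i => if i is i'.+1 then nth 0 v i' else K v) n.+1)).
  by apply: computable_comp => // -[|i] // ilt; apply: computable_nth.
exists h => v; have := Hh v; rewrite /mkseq /= -[1]add1n iotaDl -map_comp.
rewrite (_ : map _ _ = v) //; apply: (@eq_from_nth _ 0).
  by rewrite size_map size_iota size_tuple.
by move=> i; rewrite size_map size_iota => ?; rewrite (nth_map 0) ?size_iota ?nth_iota.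
Qed.

Lemma computable_add n F G : computable n F -> computable n G ->
  computable n (fun v => F v + G v).
Proof.
move=> HF HG; have := computable_rec HF HG (computable_succ (@computable_nth n.+2 1 _)).
move=> /(_ isT); apply: computable_ext => v /=.
by elim: (F v) => //= k ->.
Qed.

Lemma computable_pair n F G : computable n F -> computable n G ->
  computable n (fun v => pair_code (F v) (G v)).
Proof.
move=> HF HG; apply: computable_add => //.
(* Cantor pairing of x and y is y plus the sum of the numbers up to x + y; this recursion computes
   the sum. *)
apply: (@computable_rec n _ (fun=> 0) (fun v => (nth 0 v 0).+1 + nth 0 v 1)).
- exact: computable_add.
- exact: computable_const.
- by apply: computable_add; [apply: computable_succ|]; apply: computable_nth.
Qed.

(** * The formulas of the reduction *)

Definition step v := Conj (Lab v.+1 1) (Eq v.+1 0 v 1).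

(* Variable c + k holds the successor fact of the number k (zero if k = 0). *)
Fixpoint chain c k :=
  if k is k'.+1 then Conj (step (c + k')) (chain c k')
  else Conj (Lab c 0) (Eq 2 0 c 1).

(** Variable 2 is the goal fact: its argument is tied to [k] here, its value to zero at the base of
    [chain]. *)
Definition numeral c k := Conj (Eq 2 1 (c + k) 1) (chain c k).

Definition num_axioms :=
  Imp (Lab 0 1) (Conj (Imp (Lab 1 0) (Neg (Eq 0 1 1 1)))
    (Imp (Lab 1 1) (Imp (Eq 0 1 1 1) (Eq 0 0 1 0)))).

Definition machine (L : seq entry) kg :=
  Conj (Conj num_axioms (Lab 2 kg))
    (All (size L) (fun k => Imp (Lab 0 k) (nth entry0 L k).2)).

(* The code m of q bounds the propositions and the variables of q, so it can
   serve as the number of propositions and as the first variable of the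
   numeral: everything but q depends on m alone. *)
Definition instance (q : qf) : input :=
  let m := code q in
  existT _ m.+1 (forall2 m m.*2 (Conj q (numeral m.+1 m))).

Definition prefix_code k c :=
  nat_rec (fun=> nat) (pair_code 2 c) (fun k r => pair_code 0 (pair_code k.+2 r)) k.

Definition instance_code m :=
  pair_code m.+1 (pair_code 1 (pair_code 0 (pair_code 1 (pair_code 1
    (prefix_code (m + m) (cConj m (code (numeral m.+1 m)))))))).

Lemma chain_bounded N c k : 2 < N -> 2 < c -> bounded N (c + k).+1 (chain c k).
Proof.
move=> N3 c2; elim: k => [|k IHk] /=; first by lia.
by rewrite (bounded_leq _ IHk) ?addnS //=; lia.
Qed.

Lemma numeral_bounded N c k : 2 < N -> 2 < c -> bounded N (c + k).+1 (numeral c k).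
Proof. by move=> N3 c2; have /= -> := chain_bounded k N3 c2; lia. Qed.

(** The machine uses variables up to m and the numeral 2 and m + 1 to 2m + 1, all among the two
    universal and 2m existential ones. *)
Lemma machine_bounded L kg : let q := machine L kg in
  let m := code q in
  [/\ 2 < m, bounded m m.+1 q & bounded m m.*2.+2 (Conj q (numeral m.+1 m))].
Proof.
move=> q m; have bq : bounded m m.+1 q by apply: bounded_code.
(* The atom [Lab 0 1] of [num_axioms] is proposition 3, hence [3 <= m]. *)
have m2 : 2 < m by move: bq; rewrite /q /=; lia.
split=> //; apply/andP; split; first by apply: bounded_leq bq; lia.
by apply: bounded_leq (numeral_bounded _ _ _); lia.
Qed.

Lemma hyperltl_code_forall2 N M k p : bounded N M p ->
  hyperltl_code (forall2 N k p) =
  pair_code 1 (pair_code 0 (pair_code 1 (pair_code 1 (prefix_code k (code p))))).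
Proof.
move=> bp; rewrite /forall2 /=; do 4![congr (pair_code _ _)].
by elim: k => [|k IHk] /=; rewrite ?IHk ?(ltl_code_translate bp).
Qed.

Lemma input_code_instance L kg :
  input_code (instance (machine L kg)) = instance_code (code (machine L kg)).
Proof.
have [_ _ bq] := machine_bounded L kg.
by rewrite /input_code [tagged _]/= (hyperltl_code_forall2 _ bq) -addnn.
Qed.

Ltac computability := repeat (done || apply: computable_pair || apply: computable_succ ||
  apply: computable_add || apply: computable_const || apply: computable_nth).

Lemma code_chain c k : code (chain c k) =
  nat_rec (fun=> nat) (code (chain c 0)) (fun k r => cConj (code (step (c + k))) r) k.
Proof. by elim: k => //= k ->. Qed.

Lemma computable_instance_code : computable 1 (fun v => instance_code (nth 0 v 0)).
Proof.
have Hchain : computable 1 (fun v => code (chain (nth 0 v 0).+1 (nth 0 v 0))).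
  (* [w] lists the counter, the code built so far and m. *)
  pose s w := cConj (code (step ((nth 0 w 2).+1 + nth 0 w 0))) (nth 0 w 1).
  apply: (computable_ext (fun v => esym (code_chain _ _))).
  apply: (@computable_rec 1 _ (fun v => code (chain (nth 0 v 0).+1 0)) s); computability.
have Hcode : computable 1
    (fun v => cConj (nth 0 v 0) (code (numeral (nth 0 v 0).+1 (nth 0 v 0)))).
  computability.
do 5![apply: computable_pair; first by computability].
apply: (@computable_rec 1 _ _ (fun w => pair_code 0 (pair_code (nth 0 w 0).+2 (nth 0 w 1))));
  computability.
Qed.

(** * Correctness of the reduction *)

Lemma sat_chain E D (T : E -> Prop) lab (comp : E -> nat -> D) e c k :
  (forall v, T (e v)) -> sat lab comp e (chain c k) ->
  [/\ represents T lab comp k (comp (e (c + k)) 1), lab (e c) 0 & comp (e 2) 0 = comp (e c) 1].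
Proof.
move=> Te; elim: k => [|k IHk]; rewrite [chain _ _]/= !satE.
  by case=> L2 E2; split=> //; rewrite addn0; exists (e c).
case=> [[L2 E2] /IHk[R L1 E1]]; split=> //.
by rewrite addnS; exists (e (c + k).+1); split=> //; rewrite /= in E2; rewrite E2.
Qed.

(** By soundness of the rules the value of the goal fact represents [y]; it is also the number of a
    zero trace, which represents 0 alone. *)
Lemma satisfiable_instance_sound R L kg y : compiled R L kg ->
  satisfiable (tagged (instance (machine L kg))) ->
  R [tuple code (machine L kg)] y -> y = 0.
Proof.
have [m2 bq bm] := machine_bounded L kg.
move=> c [T [[t0 Tt0]]] /(models_forall2 T bm) H Ry.
have {}H x y' : T x -> T y' -> exists e, [/\ e 0 = x, e 1 = y', forall v, T (e v),
    sat (@tlab _) (@tcomp _) e (machine L kg) &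
    sat (@tlab _) (@tcomp _) e (numeral (code (machine L kg)).+1 (code (machine L kg)))].
  by move=> Tx Ty; have [e [E0 E1 Te]] := H x y' Tx Ty; rewrite satE => -[]; exists e.
have N : numbers_ok T (@tlab _) (@tcomp _).
  move=> t u Tt Tu; have [e [<- <- _]] := H t u Tt Tu.
  by rewrite /machine /num_axioms !satE => -[[+ _] _] _.
have C : justified L T (@tlab _) (@tcomp _).
  (* A rule justifies a single fact, so [t] fills both universal variables. *)
  move=> t k Tt kL; have [e [E0 _ Te]] := H t t Tt Tt.
  rewrite /machine !satE => -[_ Hk] _ Lt; exists e; split=> //.
  by have := Hk k kL; cbv beta; rewrite satE; apply; rewrite /= E0.
have [e [_ _ Te]] := H t0 t0 Tt0 Tt0.
rewrite /machine !satE => -[[_ L2] _] [E2 /(sat_chain Te)[R1 L0 E0]].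
have [_ _ sound] := c.
have R2 : represents T (@tlab _) (@tcomp _) y (tcomp (e 2) 0).
  apply: (sound _ _ _ _ _ N C (e 2) [tuple code (machine L kg)]) => // i.
  by rewrite ord1 (tnth_nth 0) /= in E2 *; rewrite E2.
by apply: (represents_zero N R2 (Te _) L0 (esym E0)).
Qed.

Lemma zero_factE L x : has_numbers L -> fact L x -> x.1 = 0 -> x.2 1 = 0.
Proof. by case: x => k x [L' ->] [_ /= Fx] kE; move: Fx; rewrite kE. Qed.

Lemma succ_factE L x : has_numbers L -> fact L x -> x.1 = 1 -> x.2 1 = (x.2 0).+1.
Proof. by case: x => k x [L' ->] [_ /= Fx] kE; move: Fx; rewrite kE. Qed.

Definition chain_fact k : nat * (nat -> nat) :=
  if k is k'.+1 then (1, fun i => k' + i) else (0, fun=> 0).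

Lemma sat_chain_fact e c k : (forall i, e (c + i) = chain_fact i) ->
  (e 2).2 0 = 0 -> sat flab fcomp e (chain c k).
Proof.
move=> ec e2; elim: k => [|k IHk]; rewrite [chain _ _]/= !satE.
  by have := ec 0; rewrite addn0 /= /flab /fcomp => ->.
split=> //; rewrite /= -addnS !ec /flab /fcomp /= addn0; split=> //.
by case: k {IHk} => //= k; rewrite addn1.
Qed.

Lemma satisfiable_instance_complete L kg : supported L -> has_numbers L ->
  fact L (kg, components 0 [tuple code (machine L kg)]) ->
  satisfiable (tagged (instance (machine L kg))).
Proof.
have [m2 bq bm] := machine_bounded L kg.
move=> wfL nL goalF; set m := code (machine L kg) in m2 bq bm goalF *.
exists (fun t => exists2 x, fact L x & t = trace_of m x); split.
  by eexists; exists (kg, components 0 [tuple m]).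
apply/models_forall2 => // _ _ [x Fx ->] [y Fy ->].
have [w [Fw Hw]] := wfL x Fx.
pose e1 := env x y (kg, components 0 [tuple m]) w.
have Fe1 v : fact L (e1 v) by case: v => [|[|[|v]]] //=; apply: Fw.
(* Variables up to [m] belong to the machine, later ones to the numeral. *)
pose e v := if v < m.+1 then e1 v else chain_fact (v - m.+1).
have E v : v < 3 -> e v = e1 v by move=> v3; rewrite /e (leq_trans v3) // ltnW.
exists (fun v => trace_of m (e v)); split; rewrite ?E //.
  move=> v; exists (e v) => //; rewrite /e; case: ifP => // _.
  case: (v - m.+1) => [|k]; first exact: zero_fact.
  by apply: succ_fact => //=; rewrite addn0 addn1.
apply/(sat_trace_of _ bm); rewrite satE; split.
  apply: (sat_ext bq (e := e1)) => [v vm|]; first by rewrite /e vm.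
  rewrite /machine /num_axioms !satE; split.
    split=> // L1; have {}L1 : x.1 = 1 by exact: L1.
    split=> /= Ly; rewrite /fcomp /= (succ_factE nL Fx L1).
      by rewrite (zero_factE nL Fy Ly).
    by rewrite (succ_factE nL Fy Ly) => -[].
  (* [Hw] allows anything as variables 1 and 2, in particular [y] and the goal fact. *)
  by move=> k kL; rewrite satE /= /flab /= => xk; rewrite -xk; apply: Hw.
have ec i : e (m.+1 + i) = chain_fact i.
  by rewrite /e ltnNge leq_addr /= addKn.
rewrite /numeral satE; split; last by apply: sat_chain_fact; rewrite ?E.
rewrite [sat _ _ _ _]/= ec E // /fcomp /= /components /=.
by case: (m) => //= k; rewrite addn1.
Qed.

Theorem theorem5 :
  ~ decidable_problem input_code
      (fun x : input =>
        [/\ sentence (tagged x), forall2_exists_form (tagged x)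
          & hyperltl1_FG (tagged x)])
      (fun x : input => satisfiable (tagged x)).
Proof.
move=> [f Hf].
have [h Hh] := computable_instance_code.
pose g := Comp f (fun _ : 'I_1 => h).
have Hg m y : computes f [tuple instance_code m] y -> computes g [tuple m] y.
  move=> Hy; exists [tuple instance_code m]; split=> // i.
  by rewrite ord1 (tnth_nth 0); apply: Hh.
have wf0 : supported L0.
  by move=> x Fx; exists (fun=> x); split=> // y z; case: x Fx => [[|[|k]] x] [].
have [|L' [kg [wfL c]]] := compilableP g wf0; first by exists [::].
move: (L0 ++ L') (ex_intro (fun L2 => L0 ++ L' = L0 ++ L2) L' erefl) wfL c => L nL wfL c.
have [_ _ bm] := machine_bounded L kg.
have [|Hsat Hunsat] := Hf (instance (machine L kg)).
  by split; [apply: sentence_forall2 | apply: forall2_form | apply: hyperltl1_FG_forall2].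
rewrite input_code_instance in Hsat Hunsat.
have unsat : ~ satisfiable (tagged (instance (machine L kg))).
  (* If satisfiable, [f] answers 1, so [g] maps the code of its own machine to 1, whereas soundness
     leaves only 0. *)
  by move=> S; have := satisfiable_instance_sound c S (Hg _ _ (Hsat S)).
(* Now [f] answers 0, so the goal fact is true and the instance has a model after all. *)
apply: (unsat); apply: satisfiable_instance_complete => //.
exact: compiled_fact c (Hg _ _ (Hunsat unsat)).
Qed.
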